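(* For every integer $n \geq 4$ with $n \neq 5$, there exists a basic $0,1$ matrix $M$ of size $n \times n$ with $\mathrm{rank}_{\mathbb{R}}(M) = \lfloor n/2 \rfloor + 1$ and $\mathrm{rank}_{\mathrm{bin}}(M) = \mathrm{rank}_{\mathbb{B}}(M) = i(M) = 2\lfloor n/2 \rfloor$.
   Context: A $0,1$ matrix is basic if it has no all-zero rows or columns, no two identical rows and no two identical columns. $\mathrm{rank}_{\mathbb{R}}(M)$ is the usual rank over $\mathbb{R}$. For a $0,1$ matrix $M$ of size $n\times m$, the binary rank $\mathrm{rank}_{\mathrm{bin}}(M)$ is the minimal $d$ for which there are $0,1$ matrices $A$ ($n\times d$) and $B$ ($d\times m$) with $M = A\cdot B$ over the integers; equivalently, the minimum number of all-one combinatorial rectangles (submatrices all of whose entries are $1$) needed to partition the ones of $M$. The Boolean rank $\mathrm{rank}_{\mathbb{B}}(M)$ is defined in the same way with Boolean arithmetic ($1+1=1$); equivalently, the minimum number of all-one combinatorial rectangles needed to cover the ones of $M$ (overlaps allowed). An isolation set of $M$ is a set of $1$-entries of $M$ such that no two of them are in the same row or column and no two of them belong to an all-one $2\times 2$ submatrix of $M$; $i(M)$ is the maximum size of an isolation set of $M$. *)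

(* Defs.v *)
From mathcomp Require Import all_boot all_order all_algebra.
From mathcomp Require Import reals.

Set Implicit Arguments.
Unset Strict Implicit.
Unset Printing Implicit Defensive.

Import GRing.Theory.

(* A 0,1 matrix is an element of 'M[bool]_(n, m).  MathComp's canonical ring
   structure on bool is the field F_2 (addition is xor), so products are never
   taken in 'M[bool] itself: they are taken after embedding 0 and 1 in a ring,
   or written out with && and an existential for Boolean arithmetic. *)
Definition mx01 (K : pzSemiRingType) (n m : nat) (M : 'M[bool]_(n, m)) :
    'M[K]_(n, m) :=
  map_mx (fun b : bool => (b%:R)%R) M.

Record basic (n m : nat) (M : 'M[bool]_(n, m)) : Prop := Basic {
  basic_row_nonzero : forall i, exists j, M i j;
  basic_col_nonzero : forall j, exists i, M i j;
  basic_row_inj : injective (fun i => row i M);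
  basic_col_inj : injective (fun j => col j M)
}.

Definition real_rank (R : realType) (n m : nat) (M : 'M[bool]_(n, m)) : nat :=
  \rank (mx01 R M).

Definition int_prod01 (n d m : nat)
    (M : 'M[bool]_(n, m)) (A : 'M[bool]_(n, d)) (B : 'M[bool]_(d, m)) : bool :=
  mx01 int M == (mx01 int A *m mx01 int B)%R.

Definition bool_mulmx (n d m : nat)
    (A : 'M[bool]_(n, d)) (B : 'M[bool]_(d, m)) : 'M[bool]_(n, m) :=
  (\matrix_(i, j) [exists k, A i k && B k j])%R.

Definition bin_factor (n m : nat) (M : 'M[bool]_(n, m)) (d : nat) : bool :=
  [exists A : 'M[bool]_(n, d), exists B : 'M[bool]_(d, m), int_prod01 M A B].

Definition bool_factor (n m : nat) (M : 'M[bool]_(n, m)) (d : nat) : bool :=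
  [exists A : 'M[bool]_(n, d), exists B : 'M[bool]_(d, m),
     M == bool_mulmx A B].

Lemma bin_factor_exists (n m : nat) (M : 'M[bool]_(n, m)) :
  exists d, bin_factor M d.
Proof.
exists n; apply/existsP; exists (\matrix_(i, j) (i == j))%R.
apply/existsP; exists M; apply/eqP.
suff -> : mx01 int (\matrix_(i < n, j < n) (i == j))%R = 1%:M%R.
  by rewrite mul1mx.
by apply/matrixP=> i j; rewrite !mxE.
Qed.

Lemma bool_factor_exists (n m : nat) (M : 'M[bool]_(n, m)) :
  exists d, bool_factor M d.
Proof.
exists n; apply/existsP; exists (\matrix_(i, j) (i == j))%R.
apply/existsP; exists M; apply/eqP/matrixP=> i j; rewrite mxE.
apply/idP/existsP=> [Mij | [k]]; first by exists i; rewrite mxE eqxx.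
by rewrite mxE => /andP[/eqP ->].
Qed.

Definition bin_rank (n m : nat) (M : 'M[bool]_(n, m)) : nat :=
  ex_minn (bin_factor_exists M).

Definition bool_rank (n m : nat) (M : 'M[bool]_(n, m)) : nat :=
  ex_minn (bool_factor_exists M).

Definition in_ones_2x2 (n m : nat) (M : 'M[bool]_(n, m))
    (x y : 'I_n * 'I_m) : bool :=
  [exists I : {set 'I_n}, exists J : {set 'I_m},
     [&& #|I| == 2, #|J| == 2, x \in setX I J, y \in setX I J
       & [forall i in I, forall j in J, M i j]]].

Definition isolation_set (n m : nat) (M : 'M[bool]_(n, m))
    (S : {set 'I_n * 'I_m}) : bool :=
  [forall x in S, M x.1 x.2] &&
  [forall x in S, forall y in S, (x != y) ==>
     [&& x.1 != y.1, x.2 != y.2 & ~~ in_ones_2x2 M x y]].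

Definition isolation_number (n m : nat) (M : 'M[bool]_(n, m)) : nat :=
  \max_(S : {set 'I_n * 'I_m} | isolation_set M S) #|S|.

(* Main.v *)
Require Import Defs.
From mathcomp Require Import all_boot all_order all_algebra.
From mathcomp Require Import reals.
From mathcomp Require Import zify.

(** Write [k] for half of [n], rounded down.  Start from the circulant matrix of
    order [2 k] whose row [i] has its ones in the cyclic interval [i .. i+k-1].

    It has ones on the diagonal, and for [i != j] at most one of the entries
    [(i, j)] and [(j, i)] is 1, since the cyclic distances from [i] to [j] and
    from [j] to [i] add up to [2 k].  Hence the diagonal is an isolation set of
    size [2 k].  As always [i(M) <= rank_B(M) <= rank_bin(M)], and the binary
    rank is at most the number of rows, so all three are [2 k].  On the other
    hand rows [i] and [i + k] are complementary, which brings the real rank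
    down to [k + 1]: all rows are combinations of the first [k] rows and of the
    all-ones vector.

    When [n] is odd, the matrix is bordered by a row and a column in a way that
    preserves these relations.  The new column [v] must still satisfy
    [v_i + v_(i+k) = 1]; the new row is all ones, so that it is the sum of the
    rows [0] and [k].  This sum costs no rank over the reals, and it has no
    overlap, so that it costs no binary rank either.  Finally [v] must differ
    from every circulant column, that is, it must not be a cyclic interval of
    length [k]; the choice of [extra_col] contains [1] but neither [0] nor [2].
    It needs [2 < k]; for [k = 2], the case of order 5, all four vectors with
    [v_i + v_(i+k) = 1] are circulant columns. *)

Set Implicit Arguments.
Unset Strict Implicit.

(** * Isolation number, Boolean rank and binary rank *)

(** Send each entry of the isolation set to one of the [d] all-one rectangles
    that covers it.  Two entries in the same rectangle would lie in an all-one
    [2 x 2] submatrix, so this map is injective. *)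
Lemma isolation_le_bool_factor n m (M : 'M[bool]_(n, m)) d S :
  bool_factor M d -> isolation_set M S -> #|S| <= d.
Proof.
move=> /existsP[A /existsP[B /eqP defM]] /andP[/forall_inP onesS isoS].
have rectP x : x \in S -> exists k, A x.1 k && B k x.2.
  by move=> /onesS; rewrite {1}defM mxE => /existsP.
(* The value [None] is never taken on [S]; it makes [rect] total even when
   [d] is 0. *)
pose rect x := [pick k | A x.1 k && B k x.2].
have rect_someP x : x \in S -> exists2 k, rect x = Some k & A x.1 k && B k x.2.
  move=> xS; rewrite /rect; case: pickP => [k ABk | noK]; first by exists k.
  by have [k] := rectP x xS; rewrite noK.
have rect_inj : {in S &, injective rect}.
  move=> x y xS yS; have [k -> /andP[Ax Bx]] := rect_someP x xS.
  have [l -> /andP[Ay By]] := rect_someP y yS; case=> kl; subst l.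
  have /implyP := forall_inP (forall_inP isoS x xS) y yS.
  case: eqP => //= _ /(_ isT)/and3P[ne1 ne2 /negP[]].
  apply/existsP; exists [set x.1; y.1]; apply/existsP; exists [set x.2; y.2].
  rewrite !cards2 ne1 ne2 !inE !eqxx !orbT /=.
  apply/forall_inP=> i iI; apply/forall_inP=> j jJ.
  rewrite defM mxE; apply/existsP; exists k.
  by case/set2P: iI => ->; case/set2P: jJ => ->; apply/andP.
have someS x : x \in S -> rect x \in [set~ None].
  by move=> /rect_someP[k -> _]; rewrite !inE.
have : #|rect @: S| <= #|[set~ (None : option 'I_d)]|.
  by apply/subset_leq_card/subsetP=> _ /imsetP[x /someS xP ->].
by rewrite card_in_imset // cardsC1 card_option card_ord.
Qed.

Lemma isolation_le_bool_rank n m (M : 'M[bool]_(n, m)) :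
  isolation_number M <= bool_rank M.
Proof.
apply/bigmax_leqP=> S isoS; rewrite /bool_rank.
by case: ex_minnP => d facM _; apply: isolation_le_bool_factor isoS.
Qed.

(** A sum of products of zeros and ones vanishes exactly when every product
    does, so the integer factorization is also a Boolean one. *)
Lemma bin_factor_bool_factor n m (M : 'M[bool]_(n, m)) d :
  bin_factor M d -> bool_factor M d.
Proof.
move=> /existsP[A /existsP[B /eqP/matrixP defM]].
apply/existsP; exists A; apply/existsP; exists B; apply/eqP/matrixP=> i j.
move: (defM i j); rewrite !mxE => defMij.
apply/idP/existsP=> [Mij | [k ABk]].
  apply/existsP; apply/contraT; rewrite negb_exists => /forallP noK.
  move: defMij; rewrite Mij big1 // => k _; rewrite !mxE.
  by case: (A i k) (B k j) (noK k) => [] [].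
apply/contraT=> /negPf M0; move: defMij; rewrite M0 => /esym/eqP.
rewrite Num.Theory.psumr_eq0 => [/allP/(_ k (mem_index_enum k)) | l _].
  by rewrite !mxE; case/andP: ABk => -> ->.
by rewrite !mxE -GRing.natrM Num.Theory.ler0n.
Qed.

Lemma bool_rank_le_bin_rank n m (M : 'M[bool]_(n, m)) :
  bool_rank M <= bin_rank M.
Proof.
rewrite /bin_rank; case: ex_minnP => d /bin_factor_bool_factor facM _.
by rewrite /bool_rank; case: ex_minnP => d' _; apply.
Qed.

(** * The bordered circulant matrix *)

(** Cyclically, [j - i] lies in [0 .. k-1] modulo [2 k]; the second disjunct is
    the case where the interval starting at [i] wraps around. *)
Definition circ k i j := (i <= j < i + k) || (j + k < i).

(** A set with exactly one element of each pair [{i, i + k}], [i < k]: the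
    upper one, except for [i = 1]. *)
Definition extra_col k i := (i == 1) || (k <= i) && (i != k.+1).

(** Index [2 k] is the border, which a matrix of order [2 k] does not reach;
    thus both parities of the order share this definition. *)
Definition entry k i j :=
  if i == k.*2 then true else if j == k.*2 then extra_col k i else circ k i j.

Definition bordered_circulant k n : 'M[bool]_n :=
  (\matrix_(i, j) entry k i j)%R.

Lemma entry_diag k i : 0 < k -> i <= k.*2 -> entry k i i.
Proof. by rewrite /entry /circ; do 2?[case: eqP]; lia. Qed.

(** The cyclic distances from [i] to [j] and from [j] to [i] add up to [2 k], so
    they are not both below [k]. *)
Lemma entry_asym k i j : i < k.*2 -> j < k.*2 -> i != j ->
  entry k i j -> ~~ entry k j i.
Proof. by rewrite /entry /circ; do 4?[case: eqP]; lia. Qed.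

(** The cyclic intervals of length [k] starting at [i] and [i + k] are
    complementary, and [extra_col] was chosen to extend this to the border
    column. *)
Lemma entry_compl k i j : 1 < k -> i < k -> j <= k.*2 ->
  entry k (i + k) j = ~~ entry k i j.
Proof.
move=> k_gt1 i_k j_le; apply/idP/idP; rewrite /entry.
  by do 3?[case: eqP]; rewrite /circ /extra_col; lia.
by do 3?[case: eqP]; rewrite /circ /extra_col; lia.
Qed.

(** Below the diagonal of the leading block, the interval of row [i] would have
    to wrap around, which takes [j + k < i]. *)
Lemma entry_triangular k i j : j < i <= k -> ~~ entry k i j.
Proof. by rewrite /entry /circ; do 2?[case: eqP]; lia. Qed.

(** A cyclic interval with at least two elements that contains 1 contains one of
    its neighbours.  This separates the circulant columns from [extra_col]. *)
Lemma entry_middle_neighbour k j : 2 < k -> j < k.*2 ->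
  entry k 1 j -> entry k 0 j || entry k 2 j.
Proof. by rewrite /entry; do 4?[case: eqP]; rewrite /circ; lia. Qed.

(** If two rows with index below [2 k] were equal, each would have a 1 at the
    diagonal positions of both, against [entry_asym].  The all-ones row is
    separated from any other row [i] by the 0 that row [i] has in column
    [i + k] or [i - k]. *)
Lemma entry_row_inj k i j : 0 < k -> i <= k.*2 -> j <= k.*2 ->
  (forall l, l < k.*2 -> entry k i l = entry k j l) -> i = j.
Proof.
move=> k_gt0.
wlog lt_ij : i j / i < j => [IH i_le j_le eq_ij | i_le j_le eq_ij].
  case: (ltngtP i j) => // lt_ij; first exact: IH.
  by apply/esym/IH => // l l_lt; rewrite eq_ij.
have i_lt : i < k.*2 := leq_trans lt_ij j_le.
have [j_lt|j_ge] := ltnP j k.*2.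
  have := entry_asym i_lt j_lt (negbT (ltn_eqF lt_ij)).
  by rewrite (eq_ij j) // -(eq_ij i) // !entry_diag // => /(_ isT).
have [l l_lt nEil] : exists2 l, l < k.*2 & ~~ entry k i l.
  have [i_lo|i_hi] := ltnP i k.
    by exists (i + k); [lia | rewrite /entry /circ; do 2?[case: eqP]; lia].
  by exists (i - k); [lia | rewrite /entry /circ; do 2?[case: eqP]; lia].
have j_last : j = k.*2 by lia.
by move: nEil; rewrite eq_ij // /entry j_last eqxx.
Qed.

(** The argument for circulant columns is that for rows.  The condition
    [2 < k], required only if the border column is involved, is what excludes
    order 5. *)
Lemma entry_col_inj k i j : 0 < k -> i <= k.*2 -> j <= k.*2 ->
  (maxn i j = k.*2 -> 2 < k) ->
  (forall l, l < k.*2 -> entry k l i = entry k l j) -> i = j.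
Proof.
move=> k_gt0; wlog lt_ij : i j / i < j => [IH i_le j_le mx eq_ij | i_le j_le].
  case: (ltngtP i j) => // lt_ij; first exact: IH.
  apply/esym/IH => // [|l l_lt]; first by rewrite maxnC.
  by rewrite eq_ij.
rewrite (maxn_idPr (ltnW lt_ij)) => last_gt2 eq_ij.
have i_lt : i < k.*2 := leq_trans lt_ij j_le.
have [j_lt|j_ge] := ltnP j k.*2.
  have := entry_asym i_lt j_lt (negbT (ltn_eqF lt_ij)).
  by rewrite -(eq_ij i) // (eq_ij j) // !entry_diag // => /(_ isT).
have j_last : j = k.*2 by lia.
have entry_i l : l < k.*2 -> entry k l i = extra_col k l.
  by move=> l_lt; rewrite eq_ij // /entry j_last eqxx ltn_eqF.
have := entry_middle_neighbour (last_gt2 j_last) i_lt.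
by rewrite !entry_i /extra_col; lia.
Qed.

(** * Basicness, ranks and isolation number *)

Lemma bordered_circulant_basic k n : 0 < k -> k.*2 <= n <= k.*2.+1 ->
  (n = k.*2.+1 -> 2 < k) -> basic (bordered_circulant k n).
Proof.
move=> k_gt0 /andP[n_ge n_le] n_odd.
have le_ord (i : 'I_n) : i <= k.*2 by rewrite -ltnS (leq_trans _ n_le).
have diag (i : 'I_n) : bordered_circulant k n i i by rewrite mxE entry_diag.
split=> [i | j | i j /rowP eq_ij | i j /colP eq_ij]; first by exists i.
- by exists j.
- apply/val_inj/(entry_row_inj k_gt0 (le_ord i) (le_ord j)) => l l_lt.
  by have := eq_ij (Ordinal (leq_trans l_lt n_ge)); rewrite !mxE.
- apply/val_inj/(entry_col_inj k_gt0 (le_ord i) (le_ord j))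
    => [ij_last | l l_lt].
    by apply: n_odd; have := ltn_ord i; have := ltn_ord j; lia.
  by have := eq_ij (Ordinal (leq_trans l_lt n_ge)); rewrite !mxE.
Qed.

Lemma mxrank_mxsub (F : fieldType) m n m' n' (f : 'I_m' -> 'I_m)
    (g : 'I_n' -> 'I_n) (A : 'M[F]_(m, n)) :
  \rank (mxsub f g A) <= \rank A.
Proof.
have -> : mxsub f g A = (rowsub f 1%:M *m A *m colsub g 1%:M)%R.
  by rewrite mul_rowsub_mx mul1mx -mxsub_mul mulmx1.
exact: leq_trans (mxrankM_maxl _ _) (mxrankM_maxr _ _).
Qed.

(** By [entry_compl], row [i + k] is the all-ones vector minus row [i], and the
    border row is the all-ones vector itself, so the rows [0 .. k-1] and the
    all-ones vector span all rows.  Conversely the leading block of order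
    [k + 1] is triangular with ones on its diagonal. *)
Lemma bordered_circulant_rank (F : fieldType) k n :
  1 < k -> k.*2 <= n <= k.*2.+1 ->
  \rank (mx01 F (bordered_circulant k n)) = k.+1.
Proof.
move=> k_gt1 n_k; apply/eqP; rewrite eqn_leq; apply/andP; split.
  (* [Q] lists the [k + 1] spanning rows, the all-ones vector being the last;
     [P] holds the coordinates of each row of the matrix. *)
  pose Q : 'M[F]_(k.+1, n) :=
    (\matrix_(l, j) if l == k :> nat then 1 else (entry k l j)%:R)%R.
  pose P : 'M[F]_(n, k.+1) :=
    (\matrix_(i, l) if (i < k)%N then (l == i :> nat)%:R
                    else if i == k.*2 :> nat then (l == k :> nat)%:R
                    else (l == k :> nat)%:R - (l == i - k :> nat)%N%:R)%R.
  suff -> : mx01 F (bordered_circulant k n) = (P *m Q)%R.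
    exact: mulmx_max_rank.
  have pick (m : nat) (G : 'I_k.+1 -> F) (m_k : m < k.+1) :
      (\sum_(l < k.+1) (l == m :> nat)%:R * G l)%R = G (Ordinal m_k).
    rewrite (bigD1 (Ordinal m_k)) //= eqxx GRing.mul1r big1 ?GRing.addr0 //.
    by move=> l /negPf ne; rewrite -val_eqE /= in ne; rewrite ne GRing.mul0r.
  apply/matrixP=> i j; have j_le : j <= k.*2 by have := ltn_ord j; lia.
  rewrite !mxE; under eq_bigr => l _ do rewrite !mxE.
  have [i_k|k_i] := ltnP i k.
    by rewrite (pick _ _ (leqW i_k)) /= ltn_eqF.
  have [i_last|i_ne] := eqVneq (i : nat) k.*2.
    by rewrite (pick _ _ (ltnSn k)) /= eqxx /entry i_last eqxx.
  have ik_k : i - k < k by have := ltn_ord i; lia.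
  under eq_bigr => l _ do rewrite GRing.mulrBl.
  rewrite GRing.sumrB (pick _ _ (ltnSn k)) (pick _ _ (leqW ik_k)) /=.
  rewrite eqxx (ltn_eqF ik_k) -[X in entry k X j](subnK k_i).
  rewrite entry_compl //.
  by case: (entry _ _ _); rewrite ?GRing.subrr ?GRing.subr0.
have k_n : k.+1 <= n by lia.
pose w := widen_ord k_n; pose T := mxsub w w (mx01 F (bordered_circulant k n)).
have T_unit : (T^T \in unitmx)%R.
  rewrite unitmxE det_trig; last first.
    apply/is_trig_mxP=> i j lt_ij; rewrite !mxE /=.
    by rewrite (negPf (entry_triangular _)) // lt_ij -ltnS ltn_ord.
  rewrite big1 ?GRing.unitr1 // => i _; rewrite !mxE entry_diag //=; first lia.
  by have := ltn_ord i; lia.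
rewrite -[k.+1](mxrank_unit T_unit) mxrank_tr.
exact: mxrank_mxsub.
Qed.

(** The right factor consists of the [2 k] circulant rows, extended by the
    border column.  The border row is the sum of the rows [0] and [k], as these
    are complementary. *)
Lemma bordered_circulant_bin_rank k n : 1 < k -> k.*2 <= n <= k.*2.+1 ->
  bin_rank (bordered_circulant k n) <= k.*2.
Proof.
move=> k_gt1 n_k; rewrite /bin_rank; case: ex_minnP => d _; apply.
apply/existsP.
exists (\matrix_(i, l) if i == k.*2 :> nat
  then (l == 0 :> nat) || (l == k :> nat) else l == i :> nat)%R.
apply/existsP; exists (\matrix_(l, j) entry k l j)%R.
apply/eqP/matrixP=> i j; have j_le : j <= k.*2 by have := ltn_ord j; lia.
rewrite !mxE; under eq_bigr => l _ do rewrite !mxE.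
have [i_last|i_ne] := eqVneq (i : nat) k.*2.
  have lt0 : 0 < k.*2 by lia.
  have ltk : k < k.*2 by lia.
  rewrite (bigD1 (Ordinal lt0)) //= (bigD1 (Ordinal ltk)) /=; last first.
    by rewrite -val_eqE /=; lia.
  rewrite big1 => [|l].
    have := @entry_compl k 0 j k_gt1 (ltnW k_gt1) j_le; rewrite add0n => ->.
    rewrite [entry k i j]/entry i_last !eqxx orbT !GRing.mul1r GRing.addr0.
    by case: (entry k 0 j).
  by rewrite -!val_eqE /= => /andP[/negPf-> /negPf->]; rewrite GRing.mul0r.
have i_lt : i < k.*2 by have := ltn_ord i; lia.
rewrite (bigD1 (Ordinal i_lt)) //= eqxx GRing.mul1r big1 ?GRing.addr0 // => l.
by rewrite -val_eqE /= => /negPf->; rewrite GRing.mul0r.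
Qed.

(** The first [2 k] diagonal entries form an isolation set: an all-one [2 x 2]
    submatrix through two of them would contradict [entry_asym]. *)
Lemma bordered_circulant_isolation k n : 1 < k -> k.*2 <= n <= k.*2.+1 ->
  k.*2 <= isolation_number (bordered_circulant k n).
Proof.
move=> k_gt1 /andP[n_ge n_le]; pose w := widen_ord n_ge.
have w_inj : injective w by move=> i j /(congr1 val) /= /val_inj.
pose S := [set (w i, w i) | i : 'I_(k.*2)].
have <- : #|S| = k.*2.
  by rewrite card_imset ?card_ord // => i j /(congr1 fst)/w_inj.
apply: (@leq_bigmax_cond _ (isolation_set _) (fun S => #|S|)).
apply/andP; split.
  apply/forall_inP=> _ /imsetP[i _ ->]; rewrite mxE entry_diag //=; first lia.
  exact/ltnW.
apply/forall_inP=> _ /imsetP[i _ ->]; apply/forall_inP=> _ /imsetP[j _ ->].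
apply/implyP=> ne; have {ne} ne_ij : i != j by apply: contraNneq ne => ->.
rewrite (inj_eq w_inj) ne_ij /=; apply/existsPn=> I; apply/existsPn=> J.
apply/negP=> /and5P[_ _ /setXP[/= iI iJ] /setXP[/= jI jJ] /forall_inP ones].
have := forall_inP (ones _ iI) _ jJ; have := forall_inP (ones _ jI) _ iJ.
rewrite !mxE /= => Mji Mij.
have := @entry_asym k i j.
by rewrite !ltn_ord Mij Mji => /(_ isT isT ne_ij isT).
Qed.

Theorem theorem1 (R : realType) (n : nat) (n_ge4 : 4 <= n) (n_neq5 : n <> 5) :
  exists M : 'M[bool]_n,
    [/\ basic M,
        real_rank R M = n %/ 2 + 1,
        bin_rank M = 2 * (n %/ 2),
        bool_rank M = 2 * (n %/ 2)
      & isolation_number M = 2 * (n %/ 2)].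
Proof.
set k := n %/ 2; have k_gt1 : 1 < k by lia.
have n_k : k.*2 <= n <= k.*2.+1 by lia.
exists (bordered_circulant k n); rewrite mul2n addn1.
have ge_iso := bordered_circulant_isolation k_gt1 n_k.
have iso_bool := isolation_le_bool_rank (bordered_circulant k n).
have bool_bin := bool_rank_le_bin_rank (bordered_circulant k n).
have le_bin := bordered_circulant_bin_rank k_gt1 n_k.
split; try lia; last exact: bordered_circulant_rank.
by apply: bordered_circulant_basic => // [|n_odd]; lia.
Qed.
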